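(* Let $F_n$ denote the free group on $n>1$ generators. There exists $P \in LO(F_n)$ such that $\overline{Orb_{F_n}(P)} = LO(F_n)$.
   Context: For a group $G$, $LO(G)$ is the set of all positive cones of left orderings of $G$, i.e. subsets $P \subset G$ with $P\cdot P \subset P$ and $P \sqcup P^{-1} \sqcup \{1\} = G$ (disjoint union). $LO(G)$ carries the topology with subbasis the sets $U_g = \{P \in LO(G) : g \in P\}$, $g \in G$. $G$ acts on $LO(G)$ by conjugation, $Orb_G(P) = \{gPg^{-1} : g \in G\}$, and $\overline{Orb_G(P)}$ denotes its closure in $LO(G)$. *)

(* Defs.v *)
From HB Require Import structures.
From mathcomp Require Import all_boot.
From mathcomp Require Import boolp classical_sets topology.

Set Implicit Arguments.
Unset Strict Implicit.
Unset Printing Implicit Defensive.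

Local Open Scope group_scope.

(* The letter (i, false) stands for the generator x_i and (i, true) for its
   inverse. *)
Section Words.
Variable n : nat.
Notation letter := ('I_n * bool)%type.
Implicit Types (a b : letter) (u v w : seq letter).

Definition letter_inv a : letter := (a.1, ~~ a.2).

Definition reduced w : bool := sorted (fun a b => b != letter_inv a) w.

Definition push a w : seq letter :=
  if w is b :: w' then if b == letter_inv a then w' else a :: w else [:: a].

Definition reduce w : seq letter := foldr push [::] w.

Definition word_inv w : seq letter := rev [seq letter_inv a | a <- w].

Lemma letter_invK : involutive letter_inv.
Proof. by case=> i s; rewrite /letter_inv /= negbK. Qed.

Lemma reduced_push a w : reduced w -> reduced (push a w).
Proof.
case: w => [//|b w] /= rw; case: eqVneq => [_|nb] /=; last by rewrite nb.
exact: path_sorted rw.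
Qed.

Lemma reduced_foldr u v : reduced v -> reduced (foldr push v u).
Proof. by move=> rv; elim: u => //= a u; apply: reduced_push. Qed.

Lemma reduce_reduced w : reduced (reduce w).
Proof. exact: reduced_foldr. Qed.

Lemma reduce_id w : reduced w -> reduce w = w.
Proof.
elim: w => //= a w IHw rw; rewrite IHw; last exact: path_sorted rw.
by case: w rw {IHw} => //= b w /andP[/negPf -> _].
Qed.

Lemma pushK a w : reduced w -> push (letter_inv a) (push a w) = w.
Proof.
case: w => [|b w] /=; first by rewrite letter_invK eqxx.
case: eqVneq => [->|_] /=; last by rewrite letter_invK eqxx.
by case: w => //= c w /andP[/negPf -> _].
Qed.

Lemma foldr_push_push a u v : reduced v ->
  foldr push v (push a u) = push a (foldr push v u).
Proof.
move=> rv; case: u => //= b u; case: eqVneq => [->|//].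
by rewrite -{1}[a]letter_invK pushK // reduced_foldr.
Qed.

Lemma foldr_push_reduce u v : reduced v ->
  foldr push v (reduce u) = foldr push v u.
Proof. by move=> rv; elim: u => //= a u IHu; rewrite foldr_push_push ?IHu. Qed.

Lemma reduce_cat u v : reduce (u ++ v) = foldr push (reduce v) u.
Proof. by rewrite /reduce foldr_cat. Qed.

Lemma reduce_catr u v : reduce (u ++ reduce v) = reduce (u ++ v).
Proof. by rewrite !reduce_cat reduce_id ?reduce_reduced. Qed.

Lemma reduce_catl u v : reduce (reduce u ++ v) = reduce (u ++ v).
Proof. by rewrite !reduce_cat foldr_push_reduce ?reduce_reduced. Qed.

Lemma reduced_word_inv w : reduced w -> reduced (word_inv w).
Proof.
rewrite /reduced /word_inv rev_sorted sorted_map.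
apply/sub_sorted => a b; apply: contra => /eqP /(can_inj letter_invK).
by move=> ->; rewrite letter_invK.
Qed.

Lemma reduce_mulVw w : reduce (word_inv w ++ w) = [::].
Proof.
elim: w => //= a w IHw; rewrite /word_inv /= rev_cons cat_rcons reduce_cat /=.
by rewrite -/(reduce w) pushK ?reduce_reduced // -reduce_cat.
Qed.

Lemma word_invK : involutive word_inv.
Proof.
by move=> w; rewrite /word_inv map_rev revK -map_comp map_id_in // => a _ /=;
  rewrite letter_invK.
Qed.

Lemma reduce_mulwV w : reduce (w ++ word_inv w) = [::].
Proof. by rewrite -{1}[w]word_invK reduce_mulVw. Qed.

Record free_group : predArgType :=
  FreeGroup { fgword :> seq letter; _ : reduced fgword }.

HB.instance Definition _ := [isSub for fgword].
HB.instance Definition _ := [Choice of free_group by <:].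

Implicit Types x y z : free_group.

Definition fg_one : free_group := @FreeGroup [::] isT.
Definition fg_mul x y : free_group := FreeGroup (reduce_reduced (x ++ y)).
Definition fg_inv x : free_group := FreeGroup (reduced_word_inv (valP x)).

Lemma fg_mulA : associative fg_mul.
Proof. by move=> x y z; apply: val_inj; rewrite /= reduce_catr reduce_catl catA. Qed.

Lemma fg_mul1 : left_id fg_one fg_mul.
Proof. by move=> x; apply: val_inj; rewrite /= reduce_id ?(valP x). Qed.

Lemma fg_mulr1 : right_id fg_one fg_mul.
Proof. by move=> x; apply: val_inj; rewrite /= cats0 reduce_id ?(valP x). Qed.

Lemma fg_mulV : left_inverse fg_one fg_inv fg_mul.
Proof. by move=> x; apply: val_inj; rewrite /= reduce_mulVw. Qed.

Lemma fg_mulrV : right_inverse fg_one fg_inv fg_mul.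
Proof. by move=> x; apply: val_inj; rewrite /= reduce_mulwV. Qed.

HB.instance Definition _ :=
  isGroup.Build free_group fg_mulA fg_mul1 fg_mulr1 fg_mulV fg_mulrV.

Definition fg_gen (i : 'I_n) : free_group := @FreeGroup [:: (i, false)] isT.

End Words.

Section UniversalProperty.
Variables (n : nat) (H : groupType) (f : 'I_n -> H).

Let ev (a : 'I_n * bool) : H := if a.2 then (f a.1)^-1 else f a.1.

Definition fg_lift (x : free_group n) : H := \prod_(a <- fgword x) ev a.

Lemma fg_lift_gen i : fg_lift (fg_gen i) = f i.
Proof. by rewrite /fg_lift /= big_seq1. Qed.

Lemma fg_liftM : {morph fg_lift : x y / x * y}.
Proof.
have evV a : ev a * ev (letter_inv a) = 1.
  by case: a => i [] /=; rewrite /ev /= ?mulVg ?mulgV.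
have prod_push a w : \prod_(b <- push a w) ev b = ev a * \prod_(b <- w) ev b.
  case: w => [|b w] /=; first by rewrite big_seq1 big_nil mulg1.
  case: eqVneq => [->|_]; rewrite !big_cons // mulgA evV mul1g //.
move=> x y; rewrite /fg_lift -big_cat /=.
by elim: (_ ++ _) => //= a w IHw; rewrite prod_push IHw big_cons.
Qed.

Lemma fg_lift_unique (g : free_group n -> H) :
  {morph g : x y / x * y} -> (forall i, g (fg_gen i) = f i) -> g =1 fg_lift.
Proof.
move=> gM gf; have g1 : g 1 = 1 by apply: (mulgI (g 1)); rewrite -gM !mulg1.
case=> w rw; rewrite /fg_lift /=; elim: w rw => [|a w IHw] raw.
  by rewrite big_nil -g1; congr g; apply: val_inj.
have rw := path_sorted raw; rewrite big_cons -(IHw rw).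
have ra : reduced [:: a] by [].
have -> : FreeGroup raw = FreeGroup ra * FreeGroup rw.
  by apply: val_inj; rewrite /= -{1}(reduce_id raw).
rewrite gM; congr (_ * _); case: a ra {raw} => i [] ra; rewrite /ev /=.
  rewrite -gf; apply: (mulgI (g (fg_gen i))); rewrite mulgV -gM -g1.
  by congr g; apply: val_inj; rewrite /= eqxx.
by rewrite -gf; congr g; apply: val_inj.
Qed.

End UniversalProperty.

Local Open Scope classical_set_scope.

Section LeftOrders.
Variable G : groupType.

(* Each equation below involving `&` is one of the disjointness conditions in
   P \sqcup P^-1 \sqcup {1} = G. *)
Definition positive_cone (P : set G) : Prop :=
  let Pinv := [set x^-1 | x in P] in
  [/\ [set x * y | x in P & y in P] `<=` P,
      P `|` Pinv `|` [set 1] = setT,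
      P `&` Pinv = set0,
      P `&` [set 1] = set0
    & Pinv `&` [set 1] = set0].

Record LO : Type := MkLO { cone :> set G; coneP : positive_cone cone }.

HB.instance Definition _ := gen_eqMixin LO.
HB.instance Definition _ := gen_choiceMixin LO.

Definition LO_sub (g : G) : set LO := [set P | cone P g].

HB.instance Definition _ :=
  @isSubBaseTopological.Build LO (set LO) (range LO_sub) id.

Definition conj_set (g : G) (P : set G) : set G := [set g * x * g^-1 | x in P].

Lemma conj_setE g P x : conj_set g P x <-> P (g^-1 * x * g).
Proof.
split=> [[y Py <-]|Px]; first by rewrite !mulgA mulVg mul1g mulgVK.
by exists (g^-1 * x * g) => //; rewrite !mulgA mulgV mul1g mulgK.
Qed.

Lemma invsetE (P : set G) x : [set y^-1 | y in P] x <-> P x^-1.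
Proof.
by split=> [[y Py <-]|Px]; [rewrite invgK | exists x^-1; rewrite ?invgK].
Qed.

Lemma positive_cone_conj g (P : LO) : positive_cone (conj_set g P).
Proof.
case: P => P [/= PM PT PV P1 _].
have nP1 : ~ P 1 by move=> p1; have : (P `&` [set 1]) 1 by []; rewrite P1.
have nc1 : ~ conj_set g P 1 by move/conj_setE; rewrite mulg1 mulVg.
have cV x : g^-1 * x^-1 * g = (g^-1 * x * g)^-1 by rewrite !invgM invgK mulgA.
split.
- move=> _ [x /conj_setE Px [y /conj_setE Py <-]]; apply/conj_setE.
  by apply: PM; exists (g^-1 * x * g) => //; exists (g^-1 * y * g) => //;
    rewrite !mulgA mulgK.
- apply/seteqP; split=> // x _; have : setT (g^-1 * x * g) by [].
  rewrite -PT => -[[Px|/invsetE Px]|/= x1].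
  + by left; left; apply/conj_setE.
  + by left; right; apply/invsetE/conj_setE; rewrite cV.
  + right=> /=; apply: (mulgI g^-1); apply: (mulIg g).
    by rewrite x1 mulg1 mulVg.
- apply/seteqP; split=> // x [/conj_setE Px /invsetE/conj_setE].
  rewrite cV => Pxi; suff : set0 (g^-1 * x * g) by [].
  by rewrite -PV; split=> //; apply/invsetE.
- by apply/seteqP; split=> // x [Px x1]; case: nc1; rewrite -x1.
- by apply/seteqP; split=> // x [/invsetE Px x1]; case: nc1; rewrite -invg1 -x1.
Qed.

Definition conj_LO (g : G) (P : LO) : LO := MkLO (positive_cone_conj g P).

Definition Orb (P : LO) : set LO := range (conj_LO ^~ P).

End LeftOrders.

(* Main.v *)
Require Import Defs.
From HB Require Import structures.
From mathcomp Require Import all_boot all_order all_algebra.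
From mathcomp Require Import boolp classical_sets topology.
From mathcomp Require Import lra.

(** The density of one orbit is a transitivity phenomenon.  If two left
orders [P0], [P1] and a finite set [S] of group elements are given, there is a
third order agreeing with [P0] on [S], one of whose conjugates agrees with
[P1] on [S] (lemma [glue]).  Granting this, a cone with dense orbit is built
step by step: at each step one more finite family of elements, out of an
enumeration of all of them, is made positive for some conjugate (if it is
positive for some order at all), and from then on the order is modified only in
such a way that the finitely many elements considered so far stay positive if
they are.  When every element has had its turn, the elements that became
positive for good form the required cone (lemma [limit_LO]), and its conjugates
enter every basic open set.

Gluing is done with actions on the rational line.  A base point [q] of an
order preserving action gives the left preorder comparing [g q] with [h q];
breaking its ties with any left order gives a left order, and moving the base
point from [q] to [p q] conjugates the preorder by [p].  So it suffices to find
an action in which a neighbourhood of one point looks like [P0] and a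
neighbourhood of another point of the same orbit looks like [P1].  As the group
is free, the generators may be chosen independently of each other, and as every
finite monotone partial map of the rationals extends to an automorphism of the
order (lemma [extend_monotone]), finitely many arrows between rational points
can be prescribed as soon as they are monotone (lemma [partial_action]).  Take
two copies of the ball of radius [m] of the group, the first ordered by [P0]
and lying entirely below the second, ordered by [P1], with the arrows of left
multiplication by letters.  The largest point [t] of the first copy and the
smallest point [s] of the second lie on the boundary of the ball, because an
interior point lies between its images under a letter and the inverse letter.
A boundary point has at most one letter leading back into the ball, so, with at
least two generators, some letter [b] is free to be used in an additional
arrow from [t] to [s]; this joins both balls in one orbit, and it respects the
order since [t] and [s] are extremal.

The same method yields the existence of a left order, which is needed to break
ties: a reduced word can be made to move a point upwards along a path, and the
preorders so obtained for all the words are combined lexicographically (lemma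
[lex_LO]). *)

Set Implicit Arguments.
Unset Strict Implicit.
Unset Printing Implicit Defensive.

Local Open Scope classical_set_scope.
Local Open Scope group_scope.

(** * Left orders of a group *)

Section Cones.
Variable G : groupType.
Implicit Types (P Q : LO G) (M : nat -> set G) (g h : G).

Lemma positive_coneI (C : set G) :
    (forall g h, C g -> C h -> C (g * h)) ->
    (forall g, g <> 1 -> C g \/ C g^-1) -> ~ C 1 ->
  positive_cone C.
Proof.
move=> CM CT C1; split.
- by move=> _ [g Cg [h Ch <-]]; apply: CM.
- apply/seteqP; split=> // g _; have [->|/CT[Cg|Cg]] := pselect (g = 1).
  + by right.
  + by left; left.
  + by left; right; apply/invsetE.
- apply/seteqP; split=> // g [Cg /invsetE Cgi]; apply: C1.
  by rewrite -(mulgV g); apply: CM.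
- by apply/seteqP; split=> // g [Cg g1]; apply: C1; rewrite -g1.
- by apply/seteqP; split=> // g [/invsetE Cg g1]; apply: C1; rewrite -invg1 -g1.
Qed.

Lemma LO_mul P g h : cone P g -> cone P h -> cone P (g * h).
Proof.
by case: P => C [CM ? ? ? ?] /= Cg Ch; apply: CM; exists g; last exists h.
Qed.

Lemma LO_total P g : g <> 1 -> cone P g \/ cone P g^-1.
Proof.
case: P => C [_ CT _ _ _] /= g1; have : setT g by [].
by rewrite -CT => -[[|/invsetE]|]; [left|right|].
Qed.

Lemma LO_not1 P : ~ cone P 1.
Proof.
by case: P => C [_ _ _ C1 _] /= p1; have : (C `&` [set 1]) 1 by []; rewrite C1.
Qed.

Lemma LO_asym P g : cone P g -> ~ cone P g^-1.
Proof.
by move=> Pg Pgi; apply: (@LO_not1 P); rewrite -(mulgV g); apply: LO_mul.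
Qed.

(** Each [M j] is the nonnegative cone of a total left preorder.  The order
obtained compares two elements by the first of these preorders that separates
them; it is antisymmetric because every nontrivial element is separated from
[1] by some [M j]. *)
Lemma lex_LO M :
    (forall j g h, M j g -> M j h -> M j (g * h)) ->
    (forall j g, M j g \/ M j g^-1) ->
    (forall g, g <> 1 -> exists j, ~ (M j g /\ M j g^-1)) ->
  exists P, forall g, ~ M 0 g^-1 -> cone P g.
Proof.
move=> MM MT Msep.
(* The nonnegative cone of the lexicographic preorder.  The preorder [j] matters
   only if [g] is equivalent to [1] for the earlier ones; asking there for
   [M i g^-1] alone suffices, as [M i g] then follows by induction. *)
pose L g := forall j, (forall i, i < j -> M i g^-1) -> M j g.
have LM g h : L g -> L h -> L (g * h).
  move=> Lg Lh j ghj.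
  (* If [g * h] is equivalent to [1] for the preorders before [j], then so are
     both factors, since the two are nonnegative. *)
  have gh i : i <= j -> forall k, k < i -> M k g^-1 /\ M k h^-1.
    elim: i => // i IHi ij k.
    rewrite ltnS leq_eqVlt => /predU1P[->|]; last first.
      by apply: IHi; apply: ltnW.
    have Mg : M i g by apply: (Lg) => l li; have [] := IHi (ltnW ij) l li.
    have Mh : M i h by apply: (Lh) => l li; have [] := IHi (ltnW ij) l li.
    split.
      by have := MM _ _ _ Mh (ghj i ij); rewrite invgM mulgA mulgV mul1g.
    by have := MM _ _ _ (ghj i ij) Mg; rewrite invgM -mulgA mulVg mulg1.
  apply: MM; [apply: Lg | apply: Lh] => k /(gh j (leqnn j)); by case.
have LT g : L g \/ L g^-1.
  have [|nL] := pselect (L g); first by left.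
  right; move: nL => /existsNP[j /not_implyP[gj ngj]] k; rewrite invgK => gk.
  have [kj|jk|->] := ltngtP k j; first exact: gj.
  - by case: ngj; apply: gk.
  - by case: (MT j g).
have Lasym g : L g -> L g^-1 -> g = 1.
  move=> Lg Lgi; apply: contrapT => /Msep[j]; apply; move: j.
  by elim/ltn_ind => j IH; split; [apply: Lg | apply: Lgi] => i /IH[];
    rewrite ?invgK.
have C1 : positive_cone [set g | L g /\ g <> 1].
  apply: positive_coneI => [g h [Lg g1] [Lh h1]|g g1|[]//]; last first.
    have gi1 : g^-1 <> 1 by rewrite -invg1 => /invg_inj.
    by case: (LT g); [left|right].
  split; first exact: LM.
  move=> gh1; apply: g1; apply: Lasym => //.
  by have -> : g^-1 = h by apply: (mulgI g); rewrite mulgV.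
exists (MkLO C1) => g Mg /=; split; last first.
  by move=> g1; case: (MT 0 g); rewrite g1 ?invg1 => ?; apply: Mg;
    rewrite g1 invg1.
by case: (LT g) => // Lgi; case: Mg; apply: Lgi.
Qed.

End Cones.

(** * Extending finite monotone maps of an ordered field *)

Section MonotoneMaps.
Import Order.TTheory GRing.Theory Num.Theory.
Local Open Scope ring_scope.
Variable R : realFieldType.
Implicit Types (f g : R -> R) (p q : R * R).

Definition order_auto f g : Prop :=
  [/\ cancel f g, cancel g f & {mono f : x y / x < y}].

Lemma order_autoI f g :
  cancel f g -> cancel g f -> {homo f : x y / x < y} -> order_auto f g.
Proof. by move=> fK gK /le_mono /leW_mono. Qed.

Lemma order_auto_sym f g : order_auto f g -> order_auto g f.
Proof. by case=> fK gK fm; split=> // x y; rewrite -fm !gK. Qed.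

Lemma order_auto_comp f g f' g' :
  order_auto f g -> order_auto f' g' -> order_auto (f' \o f) (g \o g').
Proof.
case=> fK gK fm [fK' gK' fm']; split; try exact: can_comp.
by move=> x y; rewrite /= fm' fm.
Qed.

(** The automorphism that is the identity above [b] and scales distances to [b]
below it; composing with such maps corrects a map at one more point to the left
of the points already handled. *)
Lemma bend_below (b x y : R) : x < b -> y < b ->
  exists f g, [/\ order_auto f g, f x = y & forall z, b <= z -> f z = z].
Proof.
move=> xb yb; pose h (k z : R) := if z < b then b + k * (z - b) else z.
have hK k l : 0 < k -> l * k = 1 -> cancel (h k) (h l).
  move=> k0 lk z; rewrite /h; case: (ltP z b) => zb; last by rewrite ltNge zb.
  by rewrite ifT; [rewrite [X in l * X]addrAC subrr
    add0r mulrA lk mul1r addrC subrK | nra].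
have hm k : 0 < k -> {homo h k : u v / u < v}.
  move=> k0 u v uv; rewrite /h.
  by case: (ltP u b) => ub; case: (ltP v b) => vb //; nra.
have k0 : 0 < (y - b) / (x - b) by rewrite ltr_ndivlMr; lra.
have xb0 : x - b != 0 by lra.
have k1 : (y - b) / (x - b) != 0 by lra.
exists (h ((y - b) / (x - b))), (h ((y - b) / (x - b))^-1); split.
- apply: order_autoI; [apply: hK| apply: hK|exact: hm] => //.
  + exact: mulVf.
  + by rewrite invr_gt0.
  + exact: mulfV.
- by rewrite /h xb divfK // addrC subrK.
- by move=> z bz; rewrite /h ltNge bz.
Qed.

(** The relation allows repetitions, so that the sorted list of prescribed
values can be used without removing duplicates. *)
Lemma extend_path p (s : seq (R * R)) :
    path (fun p q => (p == q) || (p.1 < q.1) && (p.2 < q.2)) p s ->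
  exists f g, order_auto f g /\ {in p :: s, forall q, f q.1 = q.2}.
Proof.
elim: s p => [|q s IHs] p /=.
  exists (fun x => x + (p.2 - p.1)), (fun x => x + (p.1 - p.2)); split.
    by apply: order_autoI => [x|x|x y]; lra.
  by move=> q /[!inE] /eqP ->; lra.
case/andP=> pq /[dup] qs /IHs[f [g [fg fs]]].
have [->|npq] := eqVneq p q.
  by exists f, g; split=> // r /[!inE] /orP[/eqP->|]; apply: fs;
    rewrite ?inE ?eqxx.
move: pq; rewrite (negPf npq) /= => /andP[pq1 pq2].
have fm : {mono f : x y / x < y} by case: fg.
have fq : f q.1 = q.2 by apply: fs; rewrite inE eqxx.
have fp : f p.1 < q.2 by rewrite -fq fm.
have [h [k [hk hp hq]]] := bend_below fp pq2.
exists (h \o f), (g \o k); split; first exact: order_auto_comp.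
move=> r; rewrite in_cons => /predU1P[->//|rs] /=; rewrite fs // hq //.
have tr : transitive
    (fun p q : R * R => (p == q) || (p.1 < q.1) && (p.2 < q.2)).
  move=> v u w /predU1P[->//|/andP[uv1 uv2]] /predU1P[<-|/andP[vw1 vw2]].
    by rewrite uv1 uv2 orbT.
  by rewrite (lt_trans uv1 vw1) (lt_trans uv2 vw2) orbT.
move: rs; rewrite inE => /predU1P[->//|rs].
by have /allP/(_ r rs)/predU1P[->//|/andP[_ /ltW]] := order_path_min tr qs.
Qed.

Lemma extend_monotone (s : seq (R * R)) :
    {in s &, forall p q, (p.1 < q.1) = (p.2 < q.2)} ->
  exists f g, order_auto f g /\ {in s, forall p, f p.1 = p.2}.
Proof.
move=> sm; pose e p q := p.1 <= q.1.
have eT : total e by move=> p q; apply: le_total.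
pose e' p q := (p == q) || (p.1 < q.1) && (p.2 < q.2).
have: sorted e' (sort e s).
  apply: (sub_in_sorted (P := mem s)) (sort_sorted eT s); last first.
    by apply/allP => p; rewrite mem_sort.
  move=> p q ps qs; rewrite /e /e' le_eqVlt -sm // andbb.
  case/orP=> [/eqP pq|->]; last by rewrite orbT.
  rewrite -pair_eqE /= pq ltxx eqxx /=.
  by have := sm _ _ ps qs; have := sm _ _ qs ps; rewrite pq ltxx; case: ltgtP.
have ss p : p \in s -> p \in sort e s by rewrite mem_sort.
case: (sort e s) ss => [|p t] ss.
  by move=> _; exists id, id; do !split => //; move=> p /ss.
by move=> /extend_path[f [g [fg fs]]]; exists f, g; split=> // q /ss /fs.
Qed.

End MonotoneMaps.

(** * Actions of the free group on the rational line *)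

Section Actions.
Import Order.TTheory GRing.Theory Num.Theory.
Variable n : nat.
Notation letter := ('I_n * bool)%type.
Implicit Types (a b : letter) (g h : free_group n).

Definition fg_letter a : free_group n := @FreeGroup n [:: a] isT.

Lemma fg_letterM a g : fgword (fg_letter a * g) = push a g.
Proof. by rewrite /= reduce_id // (valP g). Qed.

Lemma fg_letterV a : (fg_letter a)^-1 = fg_letter (letter_inv a).
Proof. exact: val_inj. Qed.

Lemma fg_ind (K : free_group n -> Prop) :
  K 1 -> (forall a g, fgword (fg_letter a * g) = a :: g -> K g ->
    K (fg_letter a * g)) -> forall g, K g.
Proof.
move=> K1 KM [w rw]; elim: w rw => [|a w IHw] raw.
  by have -> : FreeGroup raw = 1 by exact: val_inj.
have rw := path_sorted raw.
have E : FreeGroup raw = fg_letter a * FreeGroup rw.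
  by apply: val_inj; rewrite /= -{1}(reduce_id raw).
by rewrite E; apply: KM => //; rewrite -E.
Qed.

Definition is_action (act : free_group n -> rat -> rat) : Prop :=
  [/\ act 1 =1 id, forall g h, act (g * h) =1 act g \o act h &
    forall g, {mono act g : x y / (x < y)%R}].

(** Embeds a finite part [s] of a linearly ordered set into the rationals. *)
Definition rank (X : eqType) (lt : rel X) (s : seq X) (x : X) : rat :=
  (count (lt^~ x) s)%:R%R.

Lemma rank_mono (X : eqType) (lt : rel X) (s : seq X) :
    transitive lt -> irreflexive lt ->
    (forall x y, x != y -> lt x y || lt y x) ->
  {in s &, {mono rank lt s : x y / lt x y >-> (x < y)%R}}.
Proof.
move=> tr ir tot.
have rank_lt x y : x \in s -> lt x y -> (rank lt s x < rank lt s y)%R.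
  move=> xs xy; rewrite /rank ltr_nat.
  have sub : subpred (predU (lt^~ x) (pred1 x)) (lt^~ y).
    by move=> z /= /orP[zx|/eqP->//]; apply: tr zx xy.
  apply: leq_trans (sub_count sub s).
  have := count_predUI (lt^~ x) (pred1 x) s.
  rewrite [count (predI _ _) _](_ : _ = 0)%N; last first.
    by apply/eqP; rewrite eqn0Ngt -has_count; apply/hasPn => z _ /=;
      case: eqP => [->|]; rewrite ?ir ?andbF.
  rewrite addn0 => ->; rewrite -addn1 leq_add2l -has_count.
  by apply/hasP; exists x; rewrite //= eqxx.
move=> x y xs ys; have [->|/tot] := eqVneq x y; first by rewrite ir ltxx.
case: (boolP (lt x y)) => [xy _|_ /= yx]; first exact: rank_lt.
by apply/negbTE; rewrite -leNgt ltW ?rank_lt.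
Qed.

(** An entry [(a, (x, y))] of [E] prescribes that the letter [a] moves [x] to
[y].  A letter and its inverse must act by inverse maps; the last hypothesis is
the monotonicity requirement for two entries carrying inverse letters.  There
are no relations between the generators, so nothing else has to be checked. *)
Lemma partial_action (X : eqType) (lt : rel X) (s : seq X)
    (E : seq (letter * (X * X))) :
    transitive lt -> irreflexive lt ->
    (forall x y, x != y -> lt x y || lt y x) ->
    {in E, forall e, e.2.1 \in s /\ e.2.2 \in s} ->
    {in E &, forall e e', e.1 = e'.1 -> lt e.2.1 e'.2.1 = lt e.2.2 e'.2.2} ->
    {in E &, forall e e', e.1 = letter_inv e'.1 ->
      lt e.2.1 e'.2.2 = lt e.2.2 e'.2.1} ->
  exists act (pt : X -> rat),
    [/\ is_action act,
        {in s &, forall x y, lt x y = (pt x < pt y)%R} &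
        {in E, forall e, act (fg_letter e.1) (pt e.2.1) = pt e.2.2}].
Proof.
move=> tr ir tot Es Esame Einv; pose pt := rank lt s.
have ptm : {in s &, forall x y, lt x y = (pt x < pt y)%R}.
  by move=> x y xs ys; rewrite rank_mono.
pose L i := [seq (pt e.2.1, pt e.2.2) | e <- E & e.1 == (i, false)]
  ++ [seq (pt e.2.2, pt e.2.1) | e <- E & e.1 == (i, true)].
have /choice[f fP] i : exists fg : (rat -> rat) * (rat -> rat),
    order_auto fg.1 fg.2 /\ {in L i, forall p, fg.1 p.1 = p.2}.
  suff [f [k fkP]] : exists f k : rat -> rat,
      order_auto f k /\ {in L i, forall p, f p.1 = p.2} by exists (f, k).
  apply: extend_monotone => p q; rewrite !mem_cat.
  by case/orP=> /mapP[e]; rewrite mem_filter => /andP[/eqP ei eE] ->;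
    case/orP=> /mapP[e']; rewrite mem_filter => /andP[/eqP ei' eE'] -> /=;
    have [es1 es2] := Es e eE; have [es1' es2'] := Es e' eE';
    rewrite -!ptm //; (rewrite Esame ?ei ?ei' // || rewrite Einv ?ei ?ei').
pose lact a := if a.2 then (f a.1).2 else (f a.1).1.
have lactP a : order_auto (lact a) (lact (letter_inv a)).
  by case: a => i [] /=; rewrite /lact /=; [apply: order_auto_sym|];
    case: (fP i).
pose act g q := foldr lact q (fgword g).
have act_push a w q : foldr lact q (push a w) = lact a (foldr lact q w).
  case: w => [//|b w] /=; case: eqVneq => [->|//] /=.
  by have [_ -> _] := lactP a.
exists act, pt; split=> //.
- split=> // [g h q|g x y].
    rewrite /act /= -foldr_cat; elim: (fgword g ++ fgword h) => //= a w IHw.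
    by rewrite act_push IHw.
  rewrite /act; elim: (fgword g) => //= a w <-.
  by have [_ _ ->] := lactP a.
- case=> [[i []] [x y]] eE; rewrite /act /lact /=; have [[fK _ _] fL] := fP i.
    have <- : (f i).1 (pt y) = pt x by
      apply: (fL (pt y, pt x)); rewrite mem_cat; apply/orP; right;
      apply/mapP; exists ((i, true), (x, y)); rewrite ?mem_filter ?eqxx.
    exact: fK.
  by apply: (fL (pt x, pt y)); rewrite mem_cat; apply/orP; left;
    apply/mapP; exists ((i, false), (x, y)); rewrite ?mem_filter ?eqxx.
Qed.

End Actions.

(** * Orders coming from actions *)

Section ActionOrders.
Import Order.TTheory GRing.Theory Num.Theory.
Variable n : nat.
Implicit Types (act : free_group n -> rat -> rat) (q : rat).
Implicit Types (g h : free_group n).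

Definition weak_cone act q : set (free_group n) :=
  [set g | (q <= act g q)%R].

Lemma act_le act g : is_action act -> {mono act g : x y / (x <= y)%R}.
Proof. by case=> _ _ am x y; rewrite !leNgt am. Qed.

Lemma actK act g : is_action act -> cancel (act g) (act g^-1).
Proof.
by case=> a1 aM _ q; rewrite -[LHS]/((act g^-1 \o act g) q) -aM mulVg a1.
Qed.

Lemma actVK act g : is_action act -> cancel (act g^-1) (act g).
Proof. by move=> actP; have := actK g^-1 actP; rewrite invgK. Qed.

Lemma weak_coneM act q g h : is_action act ->
  weak_cone act q g -> weak_cone act q h -> weak_cone act q (g * h).
Proof.
move=> actP; have [_ aM _] := actP; rewrite /weak_cone /= aM /= => qg qh.
by apply: le_trans qg _; rewrite act_le.
Qed.

Lemma weak_coneV act q g : is_action act ->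
  weak_cone act q g^-1 <-> (act g q <= q)%R.
Proof. by move=> actP; rewrite /weak_cone /= -(act_le g actP) actVK. Qed.

Lemma weak_cone_total act q g : is_action act ->
  weak_cone act q g \/ weak_cone act q g^-1.
Proof.
by move=> actP; rewrite weak_coneV // /weak_cone /=; apply/orP; apply: le_total.
Qed.

(** [P0] orders the stabilizer of [q], whose elements the action does not
separate. *)
Lemma action_LO act q (P0 : LO (free_group n)) : is_action act ->
  exists P : LO (free_group n), forall g, (q < act g q)%R -> cone P g.
Proof.
move=> actP; pose M j : set (free_group n) :=
  if j is 0 then weak_cone act q else [set g | cone P0 g \/ g = 1].
have [|||P PM] := @lex_LO _ M.
- case=> [|j] g h; first exact: weak_coneM.
  by case=> [Pg|->] [Ph|->]; rewrite ?mulg1 ?mul1g /=; auto using LO_mul.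
- case=> [|j] g; first exact: weak_cone_total.
  have [->|g1] := pselect (g = 1); first by left; right.
  by case: (LO_total P0 g1); [left|right]; left.
- move=> g g1; exists 1%N; have gi1 : g^-1 <> 1 by rewrite -invg1 => /invg_inj.
  by case=> -[Pg [|//]|//]; apply: LO_asym.
exists P => g qg; apply: PM; rewrite /M weak_coneV //.
by apply/negP; rewrite -ltNge.
Qed.

End ActionOrders.

(** * Left orderability of the free group *)

HB.instance Definition _ n := [Countable of free_group n by <:].

Section Orderability.
Import Order.TTheory GRing.Theory Num.Theory.
Variable n : nat.
Notation letter := ('I_n * bool)%type.

(** The arrows of the path from [0] up to [size w] along which [w] is read, from
its last letter to its first one. *)
Fixpoint path_edges (w : seq letter) : seq (letter * (nat * nat)) :=
  if w is a :: w' then (a, (size w', (size w').+1)) :: path_edges w' else [::].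

Lemma path_edgesP w e : e \in path_edges w ->
  [/\ e.2.2 = e.2.1.+1, e.2.1 < size w &
      e.2.2 = size w -> ohead w = Some e.1].
Proof.
elim: w => //= a w IHw; rewrite inE => /predU1P[->//|/IHw[-> ltw _]].
by split=> //= [|[E]]; [apply: leqW | rewrite E ltnn in ltw].
Qed.

(** Only two consecutive arrows could conflict: they would have to carry inverse
letters, which a reduced word excludes. *)
Lemma path_edges_inv w : reduced w ->
  {in path_edges w &, forall e e', e.1 = letter_inv e'.1 ->
    (e.2.1 < e'.2.2) = (e.2.2 < e'.2.1)}.
Proof.
have invN (a : letter) : a <> letter_inv a by case: a => i [].
elim: w => //= a w IHw raw e e'; have rw : reduced w := path_sorted raw.
rewrite !in_cons => /predU1P[->|ew] /predU1P[->|ew'] /=; first by move/invN.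
- move=> _; have [-> lt _] := path_edgesP ew'.
  rewrite ltnS leqNgt lt; apply/esym/negbTE.
  by rewrite -leqNgt; apply: leqW; apply: ltnW.
- have [es lt top] := path_edgesP ew; rewrite es ltnS (ltnW lt) => ea.
  apply/esym; rewrite ltn_neqAle lt andbT; apply/eqP => sw.
  have := top (etrans es sw).
  case: w raw {IHw rw ew lt top sw} => //= b w /andP[ba _] [be].
  by rewrite be ea eqxx in ba.
- exact: IHw.
Qed.

(** The action extends the path spelled by [g], so [g] moves its bottom [0] to
its top. *)
Lemma word_action (g : free_group n) : g <> 1 ->
  exists act q, is_action act /\ (q < act g q)%R.
Proof.
move=> g1; have g0 : 0 < size g.
  by rewrite lt0n; apply: contra_notN g1 => /nilP g0; apply: val_inj.
have [||||act [pt [actP ptm actE]]] := @partial_action n nat ltn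
    (iota 0 (size g).+1) (path_edges g) ltn_trans ltnn.
- by move=> x y; rewrite /= neq_ltn.
- move=> e /path_edgesP[-> lt _]; rewrite !mem_iota /= add0n !ltnS.
  by split=> //; apply: ltnW.
- by move=> e e' /path_edgesP[-> _ _] /path_edgesP[-> _ _] _.
- by apply: path_edges_inv; apply: (valP g).
have [a1 aM _] := actP.
have walk (h : free_group n) : {subset path_edges h <= path_edges g} ->
    act h (pt 0) = pt (size h).
  elim/fg_ind: h => [|a h ah IHh] sE; first by rewrite a1.
  rewrite ah /= in sE *; rewrite aM /= IHh => [|e eh]; last first.
    by apply: sE; rewrite inE eh orbT.
  by apply: (actE (a, (size h, (size h).+1))); apply: sE; rewrite inE eqxx.
exists act, (pt 0); split=> //; rewrite walk // -ptm // mem_iota //= add0n //.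
Qed.

Lemma free_group_orderable : exists P : LO (free_group n), True.
Proof.
have /choice[M MP] (g : free_group n) : exists M : set (free_group n),
    [/\ forall h k, M h -> M k -> M (h * k), forall h, M h \/ M h^-1 &
        g <> 1 -> ~ M g^-1].
  have [->|/word_action[act [q [actP qg]]]] := pselect (g = 1).
    by exists setT; split=> //; left.
  exists (weak_cone act q); split=> [h k|h|_]; first exact: weak_coneM.
    exact: weak_cone_total.
  by rewrite weak_coneV // => qg'; rewrite ltNge qg' in qg.
pose N j := if unpickle j is Some g then M g else setT.
have [|||P _] := @lex_LO _ N; last by exists P.
- by rewrite /N => j g h; case: unpickle => // k; have [+ _ _] := MP k; apply.
- by rewrite /N => j g; case: unpickle => [k|];
    [have [_ + _] := MP k; apply | left].
- by move=> g g1; exists (pickle g); rewrite /N pickleK => -[_];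
    have [_ _] := MP g; apply.
Qed.

End Orderability.

(** * Balls and their extremal points *)

Section Balls.
Variable n : nat.
Notation letter := ('I_n * bool)%type.
Implicit Types (a b : letter) (g h t : free_group n) (P Q : LO (free_group n)).

Lemma size_letterM a g : size (fg_letter a * g) <= (size g).+1.
Proof.
rewrite fg_letterM; case: (fgword g) => [//|b w] /=.
by case: ifP => _ //=; apply: leqW.
Qed.

Definition ball m : seq (free_group n) :=
  pmap insub [seq val w | w <- enum {: m.-bseq letter}].

Lemma mem_ball m g : (g \in ball m) = (size g <= m).
Proof.
rewrite /ball mem_pmap_sub; apply/mapP/idP => [[w _ ->]|gm].
  exact: size_bseq.
by exists (Bseq gm); rewrite ?mem_enum.
Qed.

Definition before P g h : bool := `[< cone P (g^-1 * h) >].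

Lemma before_trans P : transitive (before P).
Proof.
move=> h g k /asboolP gh /asboolP hk; apply/asboolP.
by have := LO_mul gh hk; rewrite mulgA mulgK.
Qed.

Lemma before_irr P : irreflexive (before P).
Proof. by move=> g; apply/asboolP; rewrite mulVg; apply: LO_not1. Qed.

Lemma before_total P g h : g != h -> before P g h || before P h g.
Proof.
move=> /eqP gh; have [|/asboolP|/asboolP] := @LO_total _ P (g^-1 * h).
- by move=> gh1; apply: gh; apply: (mulgI g^-1); rewrite mulVg.
- by rewrite /before => ->.
- by rewrite /before invgM invgK => ->; rewrite orbT.
Qed.

Lemma beforeM P k g h : before P (k * g) (k * h) = before P g h.
Proof. by rewrite /before invgM -!mulgA (mulgA k^-1) mulVg mul1g. Qed.

Lemma extremal (R : rel (free_group n)) (s : seq (free_group n)) g :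
    transitive R -> (forall g h, g != h -> R g h || R h g) -> g \in s ->
  exists2 t, t \in s & {in s, forall h, h != t -> R t h}.
Proof.
move=> Rt RT; elim: s g => // g [_ _ _|h s IHs _ _].
  exists g; first exact: mem_head.
  by move=> h /[!inE] /eqP->; rewrite eqxx.
have [t ts tmin] := IHs h (mem_head h s).
have [gt|gt] := boolP (R g t).
  exists g; first exact: mem_head.
  move=> k; rewrite in_cons => /predU1P[->|ks kg]; first by rewrite eqxx.
  by have [->//|kt] := eqVneq k t; apply: Rt gt (tmin k ks kt).
exists t; first by rewrite in_cons ts orbT.
move=> k; rewrite in_cons => /predU1P[->|]; last exact: tmin.
by move=> /RT; rewrite (negPf gt).
Qed.

(** [K a] is meant to say that the letter [a] moves [t] to the side opposite to
the one where [t] is extremal.  A letter and its inverse move [t] to different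
sides, hence at least one of them leaves the ball. *)
Lemma extremal_size m t (K : letter -> Prop) : 0 < n -> size t <= m ->
    (forall a, K a -> ~ K (letter_inv a)) ->
    (forall a, size (fg_letter a * t) <= m -> K a) ->
  size t = m.
Proof.
move=> n0 tm Kasym Kt; apply/eqP; rewrite eqn_leq tm leqNgt; apply/negP => ltm.
have Ka a : K a by apply: Kt; apply: leq_trans (size_letterM _ _) ltm.
exact: (Kasym (Ordinal n0, false)).
Qed.

(** For each of the two lengths, at most one letter fails to increase it; there are
at least four letters. *)
Lemma exists_link g h : 1 < n ->
  exists b, size (fg_letter b * g) = (size g).+1 /\
            size (fg_letter (letter_inv b) * h) = (size h).+1.
Proof.
move=> n1; pose a0 : letter := (Ordinal (ltnW n1), false).
pose f := [:: letter_inv (head a0 g); head a0 h].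
have /hasP[b _] : has [predC f] (enum {: letter}).
  rewrite has_predC; apply/negP => /allP sub.
  have := uniq_leq_size (enum_uniq {: letter}) sub.
  rewrite -cardE card_prod card_ord card_bool /= leqNgt => /negP; apply.
  exact: leq_trans (leq_mul n1 (leqnn 2)).
move=> bf; exists b; rewrite !fg_letterM; move: bf.
rewrite /= !inE negb_or => /andP[bg bh]; split.
  case: (fgword g) bg => //= c w bc; case: eqVneq => // cb.
  by rewrite cb letter_invK eqxx in bc.
by case: (fgword h) bh => //= c w; rewrite letter_invK eq_sym => /negPf->.
Qed.

End Balls.

(** * Gluing two orders *)

Section Gluing.
Import Order.TTheory GRing.Theory Num.Theory.
Variable n : nat.
Hypothesis n1 : 1 < n.
Notation letter := ('I_n * bool)%type.
Variables (P0 P1 : LO (free_group n)) (m : nat).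
Notation point := (bool * free_group n)%type.
Implicit Types (g h : free_group n) (c : bool).

Definition side (c : bool) : LO (free_group n) := if c then P1 else P0.

Definition point_lt (x y : point) : bool :=
  if x.1 == y.1 then before (side x.1) x.2 y.2 else y.1.

Lemma point_lt_trans : transitive point_lt.
Proof.
move=> [d h] [c g] [e k]; rewrite /point_lt /=.
by case: c d e => [] [] [] //=; apply: before_trans.
Qed.

Lemma point_lt_irr : irreflexive point_lt.
Proof. by move=> [c g]; rewrite /point_lt eqxx before_irr. Qed.

Lemma point_lt_total x y : x != y -> point_lt x y || point_lt y x.
Proof.
case: x y => [c g] [d h]; rewrite /point_lt /=.
have [->|] := eqVneq c d; last by case: c d => [] [].
by rewrite xpair_eqE eqxx /= => /before_total; apply.
Qed.

Definition points : seq point :=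
  [seq (c, g) | c <- [:: false; true], g <- ball n m].

Lemma mem_points c g : ((c, g) \in points) = (size g <= m).
Proof.
apply/allpairsP/idP => [[[d h] [/= _ hm [_ ->]]]|gm].
  by rewrite -mem_ball.
by exists (c, g); rewrite mem_ball; case: c.
Qed.

Definition ball_edges : seq (letter * (point * point)) :=
  [seq e : letter * (point * point)
     <- [seq (x.2, ((x.1, g), (x.1, fg_letter x.2 * g)))
          | x <- enum {: bool * letter}, g <- ball n m]
       | size e.2.2.2 <= m].

Lemma ball_edgesP e : reflect
  (exists c a g, [/\ e = (a, ((c, g), (c, fg_letter a * g))),
                     size g <= m & size (fg_letter a * g) <= m])
  (e \in ball_edges).
Proof.
rewrite mem_filter; apply: (iffP andP) => [[+ /allpairsP[[[c a] g] [_ +]]]|].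
  by rewrite mem_ball => + gm /= E; rewrite E /=; exists c, a, g.
case=> c [a [g [-> gm agm]]]; split=> //; apply/allpairsP.
by exists ((c, a), g); rewrite mem_enum mem_ball.
Qed.

(** Transitivity: the basic open sets around [P0] and [P1] fixing the signs of
the elements of length at most [m] contain two conjugate orders. *)
Lemma glue : exists P p, forall g, size g <= m ->
  (cone P0 g -> cone P g) /\ (cone P1 g -> cone P (p^-1 * g * p)).
Proof.
have n0 := ltnW n1.
have one_ball : 1 \in ball n m by rewrite mem_ball.
have tot0 g h : g != h -> before P0 h g || before P0 g h.
  by rewrite eq_sym; apply: before_total.
have [t] := @extremal n (fun g h => before P0 h g) _ _
  (fun _ _ _ gh hk => before_trans hk gh) tot0 one_ball.
rewrite mem_ball => tm tmax.
have [s] := extremal (@before_trans n P1) (@before_total n P1) one_ball.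
rewrite mem_ball => sm smin.
have aNg a (g : free_group n) : fg_letter a * g != g.
  apply/eqP => ag; have : fg_letter a = 1 by apply: (mulIg g); rewrite mul1g.
  by move/(congr1 (@fgword n)).
have st : size t = m.
  apply: (@extremal_size n m t (fun a => before P0 (fg_letter a * t) t)) => //.
    move=> a ta; rewrite -fg_letterV -(beforeM P0 (fg_letter a)).
    rewrite mulgA mulgV mul1g.
    by move=> /(before_trans ta); rewrite before_irr.
  by move=> a atm; apply: tmax; rewrite ?mem_ball.
have ss : size s = m.
  apply: (@extremal_size n m s (fun a => before P1 s (fg_letter a * s))) => //.
    move=> a sa; rewrite -fg_letterV -(beforeM P1 (fg_letter a)).
    rewrite mulgA mulgV mul1g.
    by move=> /before_trans/(_ sa); rewrite before_irr.
  by move=> a asm; apply: smin; rewrite ?mem_ball.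
have [b []] := exists_link t s n1; rewrite st ss => bt bs.
(* The additional arrow; [tb] and [bs'] say that the arrows of the two balls
   carrying the letter [b], or its inverse, lie on the correct side of it. *)
pose link : letter * (point * point) := (b, ((false, t), (true, s))).
have tb g : size (fg_letter b * g) <= m -> size g <= m -> before P0 g t.
  move=> bgm gm; apply: tmax; rewrite ?mem_ball //.
  by apply: contraTneq bgm => ->; rewrite bt ltnn.
have bs' g : size (fg_letter (letter_inv b) * g) <= m -> size g <= m ->
    before P1 s g.
  move=> bgm gm; apply: smin; rewrite ?mem_ball //.
  by apply: contraTneq bgm => ->; rewrite bs ltnn.
have lV a g : fg_letter (letter_inv a) * (fg_letter a * g) = g.
  by rewrite -fg_letterV mulgA mulVg mul1g.
have lV' a g : fg_letter a * (fg_letter (letter_inv a) * g) = g.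
  by rewrite -fg_letterV mulgA mulgV mul1g.
have asym P g h : before P g h -> before P h g = false.
  move=> gh; apply/negP => /(before_trans gh); by rewrite before_irr.
have binv : b <> letter_inv b by case: (b) => i [].
have [||||act [pt [actP ptm actE]]] := @partial_action n point point_lt points
    (link :: ball_edges) point_lt_trans point_lt_irr.
- exact: point_lt_total.
- move=> e; rewrite in_cons => /predU1P[->|/ball_edgesP[c [a [g [-> gm agm]]]]].
    by rewrite !mem_points tm sm.
  by rewrite !mem_points.
- move=> e e'; rewrite !in_cons.
  case/predU1P=> [->|/ball_edgesP[c [a [g [-> gm agm]]]]];
    case/predU1P=> [->|/ball_edgesP[c' [a' [g' [-> gm' agm']]]]];
    rewrite /point_lt //=.
  + by rewrite !before_irr.
  + move=> ab; subst a'; case: c' => //=.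
      by rewrite bs' // lV.
    by rewrite asym // tb.
  + move=> ab; subst a; case: c => //=.
      by rewrite asym // bs' // lV.
    by rewrite tb.
  + by move=> <-; case: eqP => // _; rewrite beforeM.
- move=> e e'; rewrite !in_cons.
  case/predU1P=> [->|/ball_edgesP[c [a [g [-> gm agm]]]]];
    case/predU1P=> [->|/ball_edgesP[c' [a' [g' [-> gm' agm']]]]];
    rewrite /point_lt //=.
  + move=> ab; have {ab}ab : a' = letter_inv b by rewrite ab letter_invK.
    subst a'; case: c' => //=; first by rewrite bs'.
    by rewrite asym // tb // lV'.
  + move=> ab; subst a; case: c => //=; first by rewrite asym // bs'.
    by rewrite tb // lV'.
  + move=> ->; case: eqP => // _.
    by rewrite -(beforeM _ (fg_letter (letter_inv a')) g) lV.
have [a1 aM _] := actP.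
have walk c (g : free_group n) : size g <= m -> act g (pt (c, 1)) = pt (c, g).
  elim/fg_ind: g => [|a g ag IHg] gm; first by rewrite a1.
  have gm' : size g <= m by apply: ltnW; rewrite ag in gm.
  rewrite aM /= IHg //; apply: (actE (a, ((c, g), (c, fg_letter a * g)))).
  by rewrite in_cons; apply/orP; right; apply/ball_edgesP; exists c, a, g.
have [P PP] := action_LO (pt (false, 1)) P0 actP.
(* The route from the centre of the first ball to that of the second. *)
pose p := s^-1 * fg_letter b * t.
have pP : act p (pt (false, 1)) = pt (true, 1).
  have linkE : act (fg_letter b) (pt (false, t)) = pt (true, s).
    exact: actE (mem_head link ball_edges).
  by rewrite /p aM /= aM /= walk // linkE -(walk true s sm) actK.
have up c (g : free_group n) : size g <= m -> cone (side c) g ->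
    (pt (c, 1%g) < act g (pt (c, 1%g)))%R.
  move=> gm Pg; rewrite walk // -ptm ?mem_points //.
  by rewrite /point_lt eqxx /=; apply/asboolP; rewrite invg1 mul1g.
exists P, p => g gm; split=> Pg; apply: PP; first exact: (up false).
have [_ _ am] := actP; rewrite aM /= pP aM /= -(am p) actVK // pP.
exact: (up true).
Qed.

End Gluing.

(** * A dense orbit *)

Section Neighborhoods.
Import finmap.
Variable G : groupType.
Implicit Types P Q : LO G.

Lemma LO_nbhs P (U : set (LO G)) : nbhs P U ->
  exists S : seq G, {in S, forall g, cone P g} /\
    forall Q, {in S, forall g, cone Q g} -> U Q.
Proof.
rewrite nbhsE => -[V [[B BD BV] VP] VU].
move: VP; rewrite -BV => -[A /[dup] BA /BD [D DD DA'] AP'].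
have AP : A P := AP'; have DA : \bigcap_(X in [set` D]) X = A := DA'.
have /choice[f fP] (X : set (LO G)) : exists g, X \in D -> X = LO_sub g.
  have [/DD /set_mem [g _ <-]|XD] := boolP (X \in D); first by exists g.
  by exists 1.
exists [seq f X | X <- enum_fset D]; split.
  move=> _ /mapP[X XD ->]; move: AP; rewrite -DA => /(_ X XD).
  by rewrite [X in X P]fP.
move=> Q QS; apply: VU; rewrite -BV; exists A => //.
suff : A Q by []; rewrite -DA => X XD /=.
by rewrite [X in X Q](fP X XD); apply: QS; apply: map_f.
Qed.

End Neighborhoods.

Section Density.
Variable n : nat.
Hypothesis n1 : 1 < n.
Notation F := (free_group n).
Implicit Types (P Q : LO F) (S T : seq F) (g h p : F).

Lemma glue_seq P0 P1 S : exists P p, {in S, forall g,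
  (cone P0 g -> cone P g) /\ (cone P1 g -> cone P (p^-1 * g * p))}.
Proof.
have [P [p PP]] := glue n1 P0 P1 (\max_(g <- S) size g).
by exists P, p => g gS; apply: PP; apply: leq_bigmax_seq gS _.
Qed.

(** A state [(P, S)] of the construction consists of the current order [P] and
of the finite set [S] of elements considered so far: those of them that are
positive have to remain so. *)
Definition agrees (PS QT : LO F * seq F) : Prop :=
  {in PS.2, forall g, g \in QT.2 /\ (cone PS.1 g -> cone QT.1 g)}.

Lemma agrees_trans : forall QT PS RU : LO F * seq F,
  agrees PS QT -> agrees QT RU -> agrees PS RU.
Proof.
move=> QT PS RU PQ QR g /PQ[gT PgQg]; have [gU QgRg] := QR g gT.
by split=> // /PgQg.
Qed.

(** Each axiom of a positive cone involves finitely many elements; they have all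
been considered in some state, where the axiom holds for the current order. *)
Lemma limit_LO (st : nat -> LO F * seq F) :
    (forall k, agrees (st k) (st k.+1)) ->
    (forall g, exists k, g \in (st k).2) ->
  exists P, forall k g, g \in (st k).2 -> cone (st k).1 g -> cone P g.
Proof.
move=> st1 stF.
have st_le k l : k <= l -> agrees (st k) (st l).
  move/subnK <-; elim: (l - k) => [|i IHi]; first by [].
  exact: agrees_trans IHi (st1 _).
pose C : set F := [set g | exists2 k, g \in (st k).2 & cone (st k).1 g].
have Cup g k : g \in (st k).2 -> cone (st k).1 g -> forall l, k <= l ->
    cone (st l).1 g.
  by move=> gk Pg l kl; have [_] := st_le k l kl g gk; apply.
have C1 : positive_cone C.
  apply: positive_coneI => [g h [i gi Pg] [j hj Ph]|g g1|[k _]].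
  - have [k ghk] := stF (g * h); pose l := maxn k (maxn i j).
    have [ghl _] := st_le k l (leq_maxl _ _) _ ghk.
    exists l => //; apply: LO_mul.
      by apply: Cup gi Pg _ _; rewrite /l !leq_max leqnn orbT.
    by apply: Cup hj Ph _ _; rewrite /l !leq_max leqnn !orbT.
  - have [i gi] := stF g; have [j gj] := stF g^-1.
    have [gl _] := st_le i _ (leq_maxl i j) _ gi.
    have [gVl _] := st_le j _ (leq_maxr i j) _ gj.
    by have [Pg|Pg] := LO_total (st (maxn i j)).1 g1; [left|right];
      exists (maxn i j).
  - exact: LO_not1.
by exists (MkLO C1) => k g gk Pg; exists k.
Qed.

(** The number [k] is read both as the code of an element, which is added to
those considered, and as the code of a finite family [T], which becomes positive
for some conjugate, provided that some left order makes it positive. *)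
Lemma dense_step k (PS : LO F * seq F) : exists QT : LO F * seq F,
  [/\ agrees PS QT, forall g, unpickle k = Some g -> g \in QT.2 &
      forall T P1, unpickle k = Some T -> {in T, forall g, cone P1 g} ->
        exists p, {in T, forall g, p^-1 * g * p \in QT.2 /\
                                   cone QT.1 (p^-1 * g * p)}].
Proof.
case: PS => P S; pose T : seq F := odflt [::] (unpickle k).
pose g0 : F := odflt (1 : F) (unpickle k).
have [P1 P1T] : exists P1, forall P2, {in T, forall g, cone P2 g} ->
    {in T, forall g, cone P1 g}.
  have [[P1 P1T]|nT] := pselect (exists P1, {in T, forall g, cone P1 g}).
    by exists P1.
  by exists P => P2 P2T; case: nT; exists P2.
have [Q [p QP]] := glue_seq P P1 (S ++ T).
exists (Q, g0 :: S ++ [seq p^-1 * g * p | g <- T]); split.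
- move=> g /= gS; rewrite in_cons mem_cat gS orbT; split=> //.
  by have [|] := QP g; rewrite ?mem_cat ?gS.
- by move=> g gk; rewrite /= /g0 gk mem_head.
- move=> T' P2 kT'; have -> : T' = T by rewrite /T kT'.
  move=> /P1T P1g; exists p => g gT; split.
    by rewrite in_cons mem_cat (map_f (fun g => p^-1 * g * p) gT) !orbT.
  by have [|_] := QP g; [rewrite mem_cat gT orbT | apply; apply: P1g].
Qed.

End Density.

Theorem corollary4p1 (n : nat) (hn : (1 < n)%N) :
  exists P : LO (free_group n), closure (Orb P) = [set: LO (free_group n)]%classic.
Proof.
have [P0 _] := free_group_orderable n.
have /choice[next nextP] (kPS : nat * (LO (free_group n) * seq (free_group n))) :=
  dense_step hn kPS.1 kPS.2.
pose st := fix st k := if k is k'.+1 then next (k', st k') else (P0, [::]).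
have [k|g|P PP] := @limit_LO n st.
- by have [] := nextP (k, st k).
- by exists (pickle g).+1; have [_ + _] := nextP (pickle g, st (pickle g));
    apply; rewrite pickleK.
exists P; apply/seteqP; split=> // Q _ U /LO_nbhs[T [QT TU]].
have [_ _ /(_ T Q)[]] := nextP (pickle T, st (pickle T)) => [||p pP] //=.
  by rewrite pickleK.
exists (conj_LO p P); split; first by exists p.
apply: TU => g /pP[gk Pg]; apply/conj_setE.
exact: PP (pickle T).+1 _ gk Pg.
Qed.
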